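(* There are 85 connected cubic graphs on 12 vertices (up to isomorphism), exactly 17 of which are 3-balanced.
   Context: A graph is 3-balanced if it admits a vertex coloring $\ell:V\to\mathbb{Z}_3$ such that every vertex has, in its open neighborhood, the same number of vertices of each of the three colors. *)

(* Defs.v *)
From HB Require Import structures.
From mathcomp Require Import all_boot all_algebra all_fingroup.

Set Implicit Arguments.
Unset Strict Implicit.
Unset Printing Implicit Defensive.

Definition simple_rel (V : finType) (e : {ffun V * V -> bool}) : bool :=
  [forall x, ~~ e (x, x)] && [forall x, forall y, e (x, y) == e (y, x)].

(* The adjacency relation is a finite function, so that [sgraph V] is itself
   a finite type and sets of graphs can be counted. *)
Record sgraph (V : finType) := SGraph {
  adj_fun : {ffun V * V -> bool};
  _ : simple_rel adj_fun }.

HB.instance Definition _ (V : finType) := [isSub for @adj_fun V].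
HB.instance Definition _ (V : finType) := [Finite of sgraph V by <:].

Definition adj (V : finType) (G : sgraph V) : rel V :=
  fun x y => adj_fun G (x, y).

Definition nbhd (V : finType) (G : sgraph V) (x : V) : {set V} :=
  [set y | adj G x y].

Definition connected_graph (V : finType) (G : sgraph V) : bool :=
  (0 < #|V|) && [forall x, forall y, connect (adj G) x y].

Definition cubic (V : finType) (G : sgraph V) : bool :=
  [forall x, #|nbhd G x| == 3].

(* The colours only serve as three distinct labels: the additive structure of
   'Z_3 plays no role. *)
Definition balanced_coloring (V : finType) (G : sgraph V)
    (l : {ffun V -> 'Z_3}) : bool :=
  [forall x, forall c, forall d,
    #|[set y in nbhd G x | l y == c]| == #|[set y in nbhd G x | l y == d]|].

Definition three_balanced (V : finType) (G : sgraph V) : bool :=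
  [exists l : {ffun V -> 'Z_3}, balanced_coloring G l].

Definition isomorphic (V : finType) : rel (sgraph V) := fun G H =>
  [exists s : {perm V}, forall x, forall y, adj H (s x) (s y) == adj G x y].

Lemma isomorphic_equiv (V : finType) : equivalence_rel (@isomorphic V).
Proof.
apply/equivalence_relP; split=> [G | G H GH].
  by apply/existsP; exists 1%g; apply/'forall_forallP=> x y; rewrite !perm1.
have /existsP[s /'forall_forallP sP] := GH.
move=> K; apply/existsP/existsP => -[t /'forall_forallP tP].
  exists (s^-1 * t)%g; apply/'forall_forallP=> x y.
  by rewrite !permM (eqP (tP _ _)) -(eqP (sP _ _)) !permKV.
exists (s * t)%g; apply/'forall_forallP=> x y.
by rewrite !permM (eqP (tP _ _)) (eqP (sP _ _)).
Qed.

Definition iso_classes (V : finType) (A : {set sgraph V}) :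
    {set {set sgraph V}} :=
  equivalence_partition (@isomorphic V) A.

Definition connected_cubic_graphs (V : finType) : {set sgraph V} :=
  [set G | connected_graph G && cubic G].

(* Main.v *)
From Corelib Require Import BinNums.
Require Import Defs.
From mathcomp Require Import all_boot.
From mathcomp Require Import perm zmodp.

Set Implicit Arguments.
Unset Strict Implicit.
Unset Printing Implicit Defensive.

(* Explore a connected cubic graph vertex by vertex, recording for each newly
   processed vertex its history: the positions of its neighbours among the
   vertices processed before it.  The list of histories determines the graph up
   to isomorphism.  Unprocessed vertices with equal histories are
   interchangeable, so an exhaustive search only has to choose how many vertices
   of each history class are adjacent to the vertex being processed; it yields
   2999 codes.  Grouping the codes by an isomorphism invariant, computed from
   the numbers w2, w3 of walks of length 2 and 3 between two vertices, leaves 85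
   representatives: each code embeds into the representative with the same
   invariant, and distinct representatives have distinct invariants.  A cubic
   graph is 3-balanced iff some 3-colouring is injective on every neighbourhood,
   which is decided by enumerating partial colourings. *)

(** * Histories and exhaustive search *)

(* [P] lists the processed vertices, the latest first; the position of a vertex
   is the number of vertices after it in the list. *)
Fixpoint hist (T : Type) (e : rel T) (P : seq T) (y : T) : seq nat :=
  if P is x :: P' then
    if e y x then size P' :: hist e P' y else hist e P' y
  else [::].

Fixpoint code (T : Type) (e : rel T) (P : seq T) : seq (seq nat) :=
  if P is x :: P' then hist e P' x :: code e P' else [::].

(* A pair [(m, h)] stands for [m.+1] vertices with history [h], so that classes
   are never empty. *)
Definition cell (n : nat) (h : seq nat) (cs : seq (nat * seq nat)) :=
  if n is m.+1 then (m, h) :: cs else cs.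

Definition expand (cs : seq (nat * seq nat)) : seq (seq nat) :=
  flatten [seq nseq c.1.+1 c.2 | c <- cs].

(* All ways to choose at most [r] neighbours of vertex [i] among the classes
   [cs]; the second component counts the neighbours that remain to be discovered. *)
Fixpoint splits (k i r : nat) (cs : seq (nat * seq nat)) :
    seq (seq (nat * seq nat) * nat) :=
  if cs is (m, h) :: cs' then
    flatten [seq [seq (cell a (i :: h) (cell (m.+1 - a) h o.1), o.2 - a)
                 | a <- iota 0 (if size h < k then minn m.+1 o.2 else 0).+1]
            | o <- splits k i r cs']
  else [:: ([::], r)].

(** Here [i] vertices are processed, with code [acc], and [cs] holds the classes of discovered,
    unprocessed vertices. Any vertex of the first class may come next, so branching is over [splits]
    only. New neighbours all get the history [[:: i]]; branches with more than [n] known vertices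
    are cut. *)
Fixpoint search (k n fuel i : nat) (acc : seq (seq nat))
    (cs : seq (nat * seq nat)) : seq (seq (seq nat)) :=
  if fuel is fuel'.+1 then
    if cs is (m, h) :: cs' then
      let rest := cell m h cs' in
      flatten [seq search k n fuel' i.+1 (h :: acc)
                     (o.1 ++ cell o.2 [:: i] [::])
              | o <- splits k i (k - size h) rest
              & i.+1 + size (expand rest) + o.2 <= n]
    else if i == n then [:: acc] else [::]
  else [::].

Lemma size_hist (T : Type) (e : rel T) P y : size (hist e P y) = count (e y) P.
Proof. by elim: P => //= x P <-; case: (e y x). Qed.

Lemma hist_lt (T : Type) (e : rel T) P y : all (gtn (size P)) (hist e P y).
Proof.
elim: P => //= x P IHP.
have IHP': all (gtn (size P).+1) (hist e P y).
  by apply: sub_all IHP => j /= /ltnW.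
by case: (e y x); rewrite /= ?ltnSn.
Qed.

Lemma hist_nil (T : eqType) (e : rel T) P y :
  {in P, forall x, ~~ e y x} -> hist e P y = [::].
Proof.
move=> /hasPn/negPf ePy.
by apply/nilP; rewrite /nilp size_hist -leqn0 leqNgt -has_count ePy.
Qed.

Lemma expand_cell n h cs : expand (cell n h cs) = nseq n h ++ expand cs.
Proof. by case: n. Qed.

Lemma map_constant (S T : eqType) (f : S -> T) c s :
  {in s, forall x, f x = c} -> map f s = nseq (size s) c.
Proof.
move=> fc; rewrite -(size_map f); apply/all_pred1P/allP=> _ /mapP[x xs ->].
by rewrite /= fc.
Qed.

(** Lets the vertices themselves be reordered so that their histories spell out the class list
    literally, block by block. *)
Lemma perm_map_pull (S T : eqType) (f : S -> T) s t :
  perm_eq (map f s) t -> exists2 s', perm_eq s s' & map f s' = t.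
Proof.
case: s => [|x0 s]; first by rewrite perm_sym => /perm_nilP->; exists [::].
rewrite perm_sym => /(perm_iotaP (f x0))[Is]; rewrite size_map => eqI ->.
exists (map (nth x0 (x0 :: s)) Is).
  by rewrite perm_sym; apply/(perm_iotaP x0); exists Is.
rewrite -map_comp; apply/eq_in_map=> i.
by rewrite (perm_mem eqI) mem_iota => /andP[_ lti]; rewrite (nth_map x0 (f x0)).
Qed.

(** * Completeness of the search for connected regular graphs *)

Section Completeness.

Variables (V : finType) (e : rel V) (k : nat).
Hypothesis e_sym : symmetric e.

(** Each class of [cs] is a block of vertices of [Q]; counting the neighbours of [x] in each block
    selects the branch of [splits] that matches the graph. *)
Lemma splitsP x P cs Q r :
    perm_eq (map (hist e P) Q) (expand cs) ->
    {in Q, forall y, e y x -> size (hist e P y) < k} ->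
    count (e^~ x) Q <= r ->
  exists2 o, o \in splits k (size P) r cs &
    perm_eq (map (hist e (x :: P)) Q) (expand o.1)
    /\ o.2 = r - count (e^~ x) Q.
Proof.
elim: cs Q => [|[m h] cs IHcs] Q.
  move/perm_nilP/eqP; rewrite -size_eq0 size_map size_eq0 => /eqP-> _ _.
  by exists ([::], r); rewrite ?inE //= subn0.
move=> /perm_map_pull[Q' eqQ histQ'] ltk.
rewrite (seq.permP eqQ) => leQr.
have {}ltk: {in Q', forall y, e y x -> size (hist e P y) < k}.
  by move=> y; rewrite -(perm_mem eqQ); apply: ltk.
suff [o osplit [permo o2]] : exists2 o,
    o \in splits k (size P) r ((m, h) :: cs) &
    perm_eq (map (hist e (x :: P)) Q') (expand o.1)
    /\ o.2 = r - count (e^~ x) Q'.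
  by exists o => //; split=> //; rewrite (perm_trans _ permo) ?perm_map.
pose s1 := take m.+1 Q'; pose s2 := drop m.+1 Q'.
have defQ': Q' = s1 ++ s2 by rewrite cat_take_drop.
have hist1: map (hist e P) s1 = nseq m.+1 h.
  by rewrite map_take histQ' /expand /= take_size_cat ?size_nseq.
have hist2: map (hist e P) s2 = expand cs.
  by rewrite map_drop histQ' /expand /= drop_size_cat ?size_nseq.
have size1: size s1 = m.+1 by rewrite -(size_map (hist e P)) hist1 size_nseq.
have histh: {in s1, forall y, hist e P y = h}.
  move=> y s1y; apply/eqP; have: all (pred1 h) (map (hist e P) s1).
    by rewrite hist1 all_nseq /= eqxx.
  by move/allP/(_ _ (map_f _ s1y)).
clear histQ'; rewrite defQ' in ltk leQr *; rewrite count_cat in leQr *.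
have [|||o osplit [permo o2]] := IHcs s2; first by rewrite hist2.
- by move=> y s2y; apply: ltk; rewrite mem_cat s2y orbT.
- by apply: leq_trans leQr; rewrite leq_addl.
pose a := count (e^~ x) s1.
exists (cell a (size P :: h) (cell (m.+1 - a) h o.1), o.2 - a); last first.
  split=> /=; last by rewrite o2 -subnDA [in RHS]addnC.
  rewrite !expand_cell catA map_cat; apply: perm_cat => //.
  (* The block splits into neighbours of [x], whose history gains [size P], and the others, whose
     history stays [h]. *)
  rewrite perm_sym -(permPr (perm_map _ (permEl (perm_filterC (e^~ x) s1)))).
  rewrite perm_sym map_cat perm_cat //.
    rewrite (@map_constant _ _ _ (size P :: h)) ?size_filter //.
    by move=> y; rewrite mem_filter /= => /andP[-> s1y]; rewrite histh.
  rewrite (@map_constant _ _ _ h) ?size_filter //.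
    by rewrite -(count_predC (e^~ x) s1) in size1; rewrite -size1 addKn.
  by move=> y; rewrite mem_filter /= => /andP[/negPf-> s1y]; rewrite histh.
apply/flatten_mapP; exists o => //.
apply/mapP; exists a => //; rewrite mem_iota add0n leq0n /= ltnS.
(* The choice 0 is always offered. If [a] is positive, some vertex of the class is adjacent to [x],
   so [h] is shorter than [k] and the larger range applies. *)
have [->//|/eqP] := a =P 0.
rewrite -lt0n -has_count => /hasP[y s1y eyx].
rewrite -(histh y s1y) ltk ?mem_cat ?s1y //.
rewrite leq_min -size1 count_size o2 leq_subRL 1?addnC //.
by apply: leq_trans leQr; rewrite leq_addl.
Qed.

Hypothesis e_irr : irreflexive e.
Hypothesis e_reg : forall x, #|e x| = k.
Hypothesis e_conn : forall x y, connect e x y.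

Lemma count_nbrs x s :
  uniq s -> (forall y, e x y -> y \in s) -> count (e x) s = k.
Proof.
move=> uniqs ins; rewrite -(e_reg x) -size_filter; symmetry.
rewrite cardE; apply/perm_size/uniq_perm; rewrite ?enum_uniq ?filter_uniq //.
move=> y; rewrite mem_enum mem_filter unfold_in.
by case exy: (e x y) => //=; rewrite ins.
Qed.

Lemma count_nbrs_le x s : uniq s -> count (e x) s <= k.
Proof.
move=> uniqs; rewrite -(e_reg x) -size_filter cardE.
apply: uniq_leq_size => [|y]; first exact: filter_uniq.
by rewrite mem_enum mem_filter unfold_in => /andP[].
Qed.

(** Invariant: neighbours of processed vertices lie in [P ++ Q], and [cs] describes the histories of
    [Q]. Each step moves one vertex into [P] and keeps [fuel + size P] constant, so the fuel cannot
    run out. *)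
Lemma search_complete fuel P Q cs :
    uniq (P ++ Q) -> P ++ Q != [::] ->
    (forall x y, x \in P -> e x y -> y \in P ++ Q) ->
    perm_eq (map (hist e P) Q) (expand cs) ->
    #|V| < fuel + size P ->
  exists2 P', uniq P' /\ size P' = #|V| &
    code e P' \in search k #|V| fuel (size P) (code e P) cs.
Proof.
elim: fuel P Q cs => [|fuel IH] P Q cs uniqPQ ntPQ closP permQ.
  have: size P <= #|V|.
    rewrite -(card_uniqP _) ?max_card //.
    by move: uniqPQ; rewrite cat_uniq => /andP[].
  by rewrite add0n ltnNge => ->.
case: cs permQ => [|[m h] cs] permQ ltV.
  (* With no class left, [P] is nonempty and closed under adjacency, so connectedness makes it the
     whole vertex set. *)
  have Q0: Q = [::].
    by apply/eqP; rewrite -size_eq0 -(size_map (hist e P)) (perm_size permQ).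
  rewrite {}Q0 cats0 in uniqPQ ntPQ closP.
  have allP y : y \in P.
    case: P ntPQ closP {IH uniqPQ permQ ltV} => // x P _ closP.
    suff cl: closed e (mem (x :: P)).
      by rewrite -(closed_connect cl (e_conn x y)) mem_head.
    apply: (intro_closed (sym_connect_sym e_sym)) => u v euv uP.
    exact: closP euv.
  have sizeP: size P = #|V|.
    by rewrite -(card_uniqP uniqPQ); apply: eq_card => y; rewrite allP.
  by exists P => //; rewrite /= sizeP eqxx mem_head.
have [Q1 permQ1 /esym histQ1] := perm_map_pull permQ.
case: Q1 permQ1 histQ1 => [|x Q1] // permQ1; rewrite /expand /= => -[-> histQ1].
rewrite -/(expand cs) -/(expand ((m, h) :: cs)) in histQ1.
set hx := hist e P x.
have permPQ : perm_eq (P ++ Q) (P ++ x :: Q1) by rewrite perm_cat2l.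
rewrite (perm_uniq permPQ) in uniqPQ.
have {}closP u v : u \in P -> e u v -> v \in P ++ x :: Q1.
  by rewrite -(perm_mem permPQ); apply: closP.
pose F := [seq y <- enum V | e x y & y \notin P ++ x :: Q1].
have uniqF : uniq ((P ++ x :: Q1) ++ F).
  rewrite cat_uniq uniqPQ filter_uniq ?enum_uniq // andbT /= -all_predC.
  by apply/allP=> y; rewrite mem_filter => /andP[/andP[]].
have perm2 : perm_eq ((P ++ x :: Q1) ++ F) ((x :: P) ++ Q1 ++ F).
  by rewrite -catA /= -cat1s perm_catCA.
have clos2 u v : u \in x :: P -> e u v -> v \in (x :: P) ++ Q1 ++ F.
  rewrite -(perm_mem perm2) mem_cat inE mem_filter mem_enum andbT.
  by case/predU1P=> [-> -> | uP euv]; [case: (v \in _) | rewrite (closP u)].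
have uniq2 : uniq ((x :: P) ++ Q1 ++ F) by rewrite -(perm_uniq perm2).
have countF : count (e x) F = size F.
  apply/eqP; rewrite -all_count; apply/allP=> y.
  by rewrite mem_filter => /andP[/andP[]].
(* The neighbours of [x] are processed, already discovered, or new; this makes [o.2] below equal to
   [size F]. *)
have degx : size hx + count (e^~ x) Q1 + size F = k.
  rewrite -(count_nbrs uniq2 (clos2 x ^~ (mem_head _ _))) /= e_irr.
  rewrite add0n !count_cat countF size_hist addnA; congr (_ + _ + _).
  by apply: eq_count => y; rewrite /= e_sym.
(* Neighbours of processed vertices are already known, so a new vertex sees only [x]. *)
have histF y : y \in F -> hist e (x :: P) y = [:: size P].
  rewrite mem_filter /= => /andP[/andP[exy yPQ] _].
  rewrite e_sym exy hist_nil // => p pP; apply: contra yPQ.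
  by rewrite e_sym; apply: closP.
have [|||o osplit [permo o2]] := @splitsP x P (cell m hx cs) Q1 (k - size hx).
- by rewrite expand_cell histQ1.
(* [x] is a neighbour of [y] outside [P], which leaves fewer than [k] inside. *)
- move=> y yQ1 eyx; rewrite size_hist.
  have: count (e y) (x :: P) <= k.
    by apply: count_nbrs_le; move: uniq2; rewrite cat_uniq => /andP[].
  by rewrite /= eyx.
- by rewrite -degx -addnA addKn leq_addr.
have sizeF : o.2 = size F by rewrite o2 -degx -addnA !addKn.
have [|||||P' uP' P'in] :=
  IH (x :: P) (Q1 ++ F) (o.1 ++ cell o.2 [:: size P] [::]).
- exact: uniq2.
- by [].
- exact: clos2.
- rewrite map_cat /expand map_cat flatten_cat perm_cat //.
  rewrite -/(expand _) expand_cell cats0 sizeF.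
  by rewrite (map_constant histF).
- by rewrite /= addnS -addSn.
exists P' => //=; apply/flatten_mapP; exists o => //.
(* The size bound of the search holds because the known vertices are distinct. *)
rewrite mem_filter osplit andbT expand_cell histQ1 size_map sizeF.
rewrite -addnA -size_cat -(size_cat (x :: P)) -(card_uniqP uniq2).
exact: max_card.
Qed.

End Completeness.

(** * Invariance under isomorphism *)

Lemma hist_map (S T : Type) (f : S -> T) (e : rel T) P y :
  hist e (map f P) (f y) = hist (relpre f e) P y.
Proof. by elim: P => //= x P ->; rewrite size_map. Qed.

Lemma code_map (S T : Type) (f : S -> T) (e : rel T) P :
  code e (map f P) = code (relpre f e) P.
Proof. by elim: P => //= x P ->; rewrite hist_map. Qed.

Lemma eq_code (T : Type) (e e' : rel T) P : e =2 e' -> code e P = code e' P.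
Proof.
move=> ee'; elim: P => //= x P ->; congr (_ :: _).
by elim: P => //= y P ->; rewrite ee'.
Qed.

Lemma size_code (T : Type) (e : rel T) P : size (code e P) = size P.
Proof. by elim: P => //= x P ->. Qed.

(** Positions in a history over [P] are below [size P], so a head equal to [size P] over [x :: P]
    decides adjacency to the newest vertex [x]. *)
Lemma hist_inj (S T : Type) (e : rel S) (e' : rel T) P P' y y' :
    size P = size P' -> hist e P y = hist e' P' y' ->
  map (e y) P = map (e' y') P'.
Proof.
elim: P P' => [|x P IHP] [|x' P'] //= [sizeP].
have := hist_lt e P y; have := hist_lt e' P' y'.
case: (e y x) (e' y' x') => [] [] lt' lt eqh; last by rewrite (IHP P').
- by case: eqh => _ eqh; rewrite (IHP P').
- by rewrite -eqh /= sizeP ltnn in lt'.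
- by rewrite eqh /= sizeP ltnn in lt.
Qed.

(** Each entry of a code is a row of the adjacency matrix below the diagonal; symmetry and
    irreflexivity supply the rest. *)
Lemma code_inj (S T : Type) (e : rel S) (e' : rel T) P P' x0 x0' :
    symmetric e -> irreflexive e -> symmetric e' -> irreflexive e' ->
    code e P = code e' P' ->
  {in gtn (size P) &, forall i j,
    e (nth x0 P i) (nth x0 P j) = e' (nth x0' P' i) (nth x0' P' j)}.
Proof.
move=> symE irrE symE' irrE'; elim: P P' => [|x P IHP] [|x' P'] //= [].
move=> eqh eqc; have sizeP: size P = size P'.
  by rewrite -(size_code e) eqc size_code.
have row i : i < size P -> e x (nth x0 P i) = e' x' (nth x0' P' i).
  move=> ltiP; rewrite -(nth_map x0 false) // (hist_inj sizeP eqh).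
  by rewrite (nth_map x0') // -sizeP.
case=> [|i] [|j] //= ltiP ltjP.
- by rewrite irrE irrE'.
- exact: row.
- by rewrite symE symE' row.
- exact: (IHP P').
Qed.

Lemma uniq_full (V : finType) (P : seq V) x :
  uniq P -> size P = #|V| -> x \in P.
Proof.
move=> uP sizeP; apply/idPn=> Px.
have: size (x :: P) <= #|V|.
  by rewrite -(card_uniqP _) ?max_card //= Px.
by rewrite /= sizeP ltnn.
Qed.

Lemma adj_sym (V : finType) (G : sgraph V) : symmetric (adj G).
Proof.
by case: G => f fP x y; case/andP: (fP) => _ /'forall_forallP/(_ x y)/eqP.
Qed.

Lemma adj_irr (V : finType) (G : sgraph V) : irreflexive (adj G).
Proof.
by case: G => f fP x; apply/negbTE; case/andP: (fP) => /forallP/(_ x).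
Qed.

(** Matching positions in the two lists is a bijection, since [P] exhausts the vertices; by
    [code_inj] it preserves adjacency. *)
Lemma code_isomorphic (V : finType) (G H : sgraph V) P P' :
    uniq P -> size P = #|V| -> uniq P' ->
    code (adj G) P = code (adj H) P' ->
  isomorphic G H.
Proof.
move=> uP sizeP uP' eqc.
have sizeP' : size P' = size P by rewrite -(size_code (adj H)) -eqc size_code.
have idx x : index x P < size P by rewrite index_mem uniq_full.
pose f x := nth x P' (index x P).
have f_inj : injective f.
  move=> x y; rewrite /f (set_nth_default x y) ?sizeP' // => /eqP.
  rewrite nth_uniq ?sizeP' // => /eqP eqi.
  by rewrite -(nth_index x (uniq_full x uP sizeP)) eqi nth_index ?uniq_full.
apply/existsP; exists (perm f_inj); apply/'forall_forallP=> x y; apply/eqP.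
rewrite !permE /f (set_nth_default x y) ?sizeP' //.
rewrite -(@code_inj _ _ _ _ P P' x x (@adj_sym _ G) (@adj_irr _ G)
  (@adj_sym _ H) (@adj_irr _ H) eqc) ?inE //.
by rewrite !nth_index // uniq_full.
Qed.

Lemma isomorphicP (V : finType) (G H : sgraph V) :
  reflect (exists s : {perm V}, forall x y, adj H (s x) (s y) = adj G x y)
          (isomorphic G H).
Proof.
apply: (iffP existsP) => -[s sP]; exists s.
  by move=> x y; apply/eqP; move/'forall_forallP: sP.
by apply/'forall_forallP=> x y; rewrite sP.
Qed.

(** The hypotheses make [g] enumerate a transversal of the classes, without repetition. *)
Lemma card_equivalence_partition (T : finType) (R : rel T) (A : {set T})
    (I : eqType) (rs : seq I) (g : I -> T) :
    equivalence_rel R -> uniq rs ->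
    {in rs &, forall i j, R (g i) (g j) -> i = j} ->
    {in rs, forall i, g i \in A} ->
    {in A, forall x, exists2 i, i \in rs & R x (g i)} ->
  #|equivalence_partition R A| = size rs.
Proof.
move=> eqR urs injg gA covA.
pose B x := [set y in A | R x y].
have Rxx x : R x x by exact: (eqR x x x).1.
have Rl x y z : R x y -> R x z = R y z by exact: (eqR x y z).2.
have injB : {in rs &, injective (B \o g)}.
  move=> i j irs jrs /setP/(_ (g j)); rewrite !inE gA // Rxx => Rij.
  by apply: injg.
have -> : equivalence_partition R A = [set X in map (B \o g) rs].
  apply/setP=> X; rewrite inE; apply/imsetP/mapP => [[x Ax ->]|[i irs ->]].
    have [i irs Rxi] := covA x Ax; exists i => //.
    by apply/setP=> y; rewrite !inE (Rl _ _ _ Rxi).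
  by exists (g i); rewrite ?gA.
by rewrite cardsE (card_uniqP _) ?size_map // map_inj_in_uniq.
Qed.

(** * The walk invariant and transport of 3-balancedness *)

Section Invariant.

Variable V : finType.
Implicit Types (e : rel V) (G H : sgraph V).

Definition walks2 e x y := \sum_(z | e x z) (e y z : nat).
Definition walks3 e x y := \sum_(z | e x z) walks2 e z y.
(* Found by experiment: small values, and together the two sums separate the 85
   connected cubic graphs on 12 vertices. *)
Definition walk_sums e : nat * nat :=
  (\sum_x \sum_y walks2 e x y ^ 2 * walks3 e x y,
   \sum_x \sum_y walks3 e x y ^ 2).

Lemma walk_sums_isomorphic G H :
  isomorphic G H -> walk_sums (adj G) = walk_sums (adj H).
Proof.
case/isomorphicP=> s sP; have s_inj := @perm_inj _ s.
have w2 x y : walks2 (adj H) (s x) (s y) = walks2 (adj G) x y.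
  rewrite /walks2 (reindex_inj s_inj); apply: eq_big => z; first exact: sP.
  by rewrite !sP.
have w3 x y : walks3 (adj H) (s x) (s y) = walks3 (adj G) x y.
  rewrite /walks3 (reindex_inj s_inj); apply: eq_big => z; first exact: sP.
  by rewrite w2.
by congr (_, _); rewrite [RHS](reindex_inj s_inj); apply: eq_bigr => x _;
  rewrite [RHS](reindex_inj s_inj); apply: eq_bigr => y _; rewrite !(w2, w3).
Qed.

(** The three colour counts in a neighbourhood add up to 3, so they are equal exactly when no colour
    repeats. *)
Lemma balanced_coloringP G (l : {ffun V -> 'Z_3}) : cubic G ->
  reflect (forall x y z, adj G x y -> adj G x z -> l y = l z -> y = z)
          (balanced_coloring G l).
Proof.
move=> /forallP cubG.
pose N x c := [set y in nbhd G x | l y == c].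
have sumN x : #|N x ord0| + #|N x (inord 1)| + #|N x (inord 2)| = 3.
  rewrite -[RHS](eqP (cubG x)) -[RHS]sum1_card (partition_big l predT) //=.
  rewrite !big_ord_recr big_ord0 /= add0n; congr (_ + _ + _);
    rewrite -sum1_card; apply: eq_big => // y; rewrite !inE //;
    by congr (_ && (_ == _)); apply/val_inj; rewrite /= ?inordK.
have cases (c : 'Z_3) : [\/ c = ord0, c = inord 1 | c = inord 2].
  case: c => [[|[|[|c]]] lt3] //; [apply: Or31|apply: Or32|apply: Or33];
    by apply/val_inj; rewrite /= ?inordK.
apply: (iffP 'forall_'forall_'forall_eqP) => [bal x y z xy xz lyz | inj x c d].
  have : #|N x (l y)| <= 1.
    (* After tripling, the right side 3 is the sum of the colour counts, all equal to this one. *)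
    by rewrite -(@leq_pmul2l 3) // !mulSn mul0n addn0 addnA -[leqRHS](sumN x)
      -!(bal x (l y)).
  by move/card_le1_eqP; apply; rewrite !inE ?xy ?xz ?lyz ?eqxx.
have N1 b : #|N x b| <= 1.
  apply/card_le1_eqP=> y z; rewrite !inE => /andP[xy /eqP ly] /andP[xz /eqP lz].
  by apply: (inj x) => //; rewrite ly lz.
have {}N1 b : #|N x b| = 1.
  move: (sumN x) (N1 ord0) (N1 (inord 1)) (N1 (inord 2)).
  case: (cases b) => ->; case: #|N x ord0| => [|[|?]] //;
    by case: #|N x (inord 1)| => [|[|?]] //; case: #|N x (inord 2)| => [|[|?]].
by rewrite (N1 c) (N1 d).
Qed.

Lemma three_balanced_isomorphic G H : cubic G -> cubic H ->
  isomorphic G H -> three_balanced G -> three_balanced H.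
Proof.
move=> cG cH /isomorphicP[s sP] /existsP[l /(balanced_coloringP _ cG) lP].
apply/existsP; exists [ffun x => l (s^-1 x)%g]; apply/balanced_coloringP=> //.
move=> x y z; rewrite -{1 2}(permKV s x) -{1}(permKV s y) -{1}(permKV s z).
rewrite !sP !ffunE => xy xz lyz.
by rewrite -(permKV s y) -(permKV s z) (lP _ _ _ xy xz lyz).
Qed.

End Invariant.

(** * Graphs given by neighbour lists *)

Definition nb_adj (nb : seq (seq nat)) : rel nat :=
  fun x y => y \in nth [::] nb x.

(** A code stores each edge once, at its later endpoint, and lists the latest vertex first; hence
    the reversal and the disjunction. *)
Definition nbrs (n : nat) (c : seq (seq nat)) : seq (seq nat) :=
  let r := rev c in
  [seq [seq y <- iota 0 n | (x \in nth [::] r y) || (y \in nth [::] r x)]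
  | x <- iota 0 n].

(** The last clause certifies connectedness: descending along smaller neighbours ends at 0. *)
Definition regular_bfs (k n : nat) (nb : seq (seq nat)) : bool :=
  all (fun x => let s := nth [::] nb x in
    [&& uniq s, size s == k,
        all (fun y => [&& y < n, y != x & x \in nth [::] nb y]) s
      & (x == 0) || has (gtn x) s]) (iota 0 n).

(** [f] lists images latest first, so position [j] has index [size f - j.+1]. A vertex with a
    nonempty history is tried only on neighbours of the image of its latest earlier neighbour. *)
Fixpoint embeddings (n : nat) (nb c : seq (seq nat)) : seq (seq nat) :=
  if c is h :: c' then
    [seq x :: f | f <- embeddings n nb c',
       x <- [seq x <- if h is j :: _ then nth [::] nb (nth 0 f (size f - j.+1))
                      else iota 0 n
            | [&& x < n, x \notin f & hist (nb_adj nb) f x == h]]]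
  else [:: [::]].

Definition table (n : nat) (F : nat -> nat -> nat) : seq (seq nat) :=
  [seq [seq F x y | y <- iota 0 n] | x <- iota 0 n].

Definition entry (t : seq (seq nat)) (x y : nat) : nat :=
  nth 0 (nth [::] t x) y.

(* Binary numbers make comparing two invariants cheap. *)
Definition nb_walk_sums (n : nat) (nb : seq (seq nat)) : N * N :=
  let W2 := table n (fun x y => count (mem (nth [::] nb y)) (nth [::] nb x)) in
  let W3 := table n (fun x y => sumn [seq entry W2 z y | z <- nth [::] nb x]) in
  let sum F := bin_of_nat (sumn (flatten (table n F))) in
  (sum (fun x y => entry W2 x y ^ 2 * entry W3 x y),
   sum (fun x y => entry W3 x y ^ 2)).

(** Separating distinct siblings by colour means being injective on every neighbourhood. *)
Definition siblings (n : nat) (nb : seq (seq nat)) : rel nat :=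
  fun x y => has (fun z => (x \in nth [::] nb z) && (y \in nth [::] nb z))
                 (iota 0 n).

Fixpoint colorings (q : nat) (clash : rel nat) (m : nat) : seq (seq nat) :=
  if m is m'.+1 then
    [seq rcons s c | s <- colorings q clash m',
       c <- [seq c <- iota 0 q
            | all (fun y => clash m' y ==> (nth 0 s y != c)) (iota 0 m')]]
  else [:: [::]].

Fixpoint collect_reps (n : nat) (cs : seq (seq (seq nat)))
    (reps : seq ((N * N) * seq (seq nat))) :
    option (seq ((N * N) * seq (seq nat))) :=
  if cs is c :: cs' then
    let nb := nbrs n c in let w := nb_walk_sums n nb in
    (* not [&&], whose second argument call-by-value always evaluates *)
    if has (fun r => if r.1 == w then embeddings n r.2 c != [::] else false)
           reps
    then collect_reps n cs' reps
    else if embeddings n nb c != [::] then collect_reps n cs' ((w, nb) :: reps)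
    else None
  else Some reps.

(** The start is a single discovered vertex with empty history; fuel 13 covers 12 steps and the
    final call. *)
Definition cubic12_codes := search 3 12 13 0 [::] [:: (0, [::])].

Definition check_reps (a b : nat) (reps : seq ((N * N) * seq (seq nat))) :=
  let nbs := [seq r.2 | r <- reps] in
  [&& all (regular_bfs 3 12) nbs, uniq [seq nb_walk_sums 12 nb | nb <- nbs],
    size nbs == a &
    size [seq nb <- nbs | colorings 3 (siblings 12 nb) 12 != [::]] == b].

Fact symmetrized_simple (V : finType) (a : rel V) :
  simple_rel [ffun p : V * V => (p.1 != p.2) && (a p.1 p.2 || a p.2 p.1)].
Proof.
apply/andP; split; first by apply/forallP=> x; rewrite ffunE eqxx.
apply/'forall_forallP=> x y.
by rewrite !ffunE /= [y == x]eq_sym [a y x || _]orbC.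
Qed.

(** Symmetrising and dropping loops defines a graph from any relation; under [regular_bfs] both
    change nothing. *)
Definition sgraph_of (V : finType) (a : rel V) : sgraph V :=
  SGraph (symmetrized_simple a).

Definition nb_graph (n : nat) (nb : seq (seq nat)) : sgraph 'I_n :=
  sgraph_of (relpre val (nb_adj nb) : rel 'I_n).

Lemma big_ord_mem (n : nat) (s : seq nat) (F : nat -> nat) :
  uniq s -> all (gtn n) s -> \sum_(y <- s) F y = \sum_(y < n | val y \in s) F y.
Proof.
move=> us sn; rewrite -(big_mkord (fun y => y \in s) F) -[RHS]big_filter.
apply/perm_big/uniq_perm; rewrite ?filter_uniq ?iota_uniq // => y.
rewrite mem_filter mem_index_iota /= andb_idr //.
by move/(allP sn).
Qed.

Section Decoding.

Variables (k n : nat) (nb : seq (seq nat)).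
Hypothesis nbP : regular_bfs k n nb.

Lemma regular_bfsP x : x < n ->
  [/\ uniq (nth [::] nb x), size (nth [::] nb x) = k,
      forall y, nb_adj nb x y -> [/\ y < n, y != x & nb_adj nb y x]
    & x = 0 \/ exists2 y, y < x & nb_adj nb x y].
Proof.
move=> ltxn; have /allP/(_ x) := nbP; rewrite mem_iota /= add0n ltxn.
case/(_ isT)/and4P=> us /eqP sk /allP sP /orP x0; split=> //.
  by move=> y /sP/and3P[].
case: x0 => [/eqP|/hasP[y sy ltyx]]; [by left | by right; exists y].
Qed.

Lemma adj_nb_graph x y : adj (nb_graph n nb) x y = nb_adj nb x y.
Proof.
rewrite /adj /= ffunE /=; apply/idP/idP; last first.
  move=> xy; rewrite xy andbT eq_sym.
  by have [_ _ /(_ _ xy)[_ yx _] _] := regular_bfsP (ltn_ord x).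
case/andP=> _ /orP[] // yx.
by have [_ _ /(_ _ yx)[] ] := regular_bfsP (ltn_ord y).
Qed.

Lemma nb_all x : x < n -> all (gtn n) (nth [::] nb x).
Proof.
by case/regular_bfsP=> _ _ sP _; apply/allP=> y /sP[].
Qed.

Lemma sum_nbrs (F : nat -> nat) (x : 'I_n) :
  \sum_(y <- nth [::] nb x) F y = \sum_(y | adj (nb_graph n nb) x y) F y.
Proof.
have [us _ _ _] := regular_bfsP (ltn_ord x).
rewrite (@big_ord_mem n) ?nb_all //; apply: eq_bigl => y.
by rewrite adj_nb_graph.
Qed.

Lemma cubic_nb_graph : k = 3 -> cubic (nb_graph n nb).
Proof.
move=> k3; apply/forallP=> x; rewrite -sum1_card.
have [_ sk _ _] := regular_bfsP (ltn_ord x).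
rewrite (eq_bigl (adj (nb_graph n nb) x)); last by move=> y; rewrite inE.
by rewrite -(sum_nbrs (fun=> 1)) sum1_size sk k3.
Qed.

Lemma connected_nb_graph : 0 < n -> connected_graph (nb_graph n nb).
Proof.
move=> n_gt0; rewrite /connected_graph card_ord n_gt0 /=.
have cs := sym_connect_sym (@adj_sym _ (nb_graph n nb)).
suff c0 x : connect (adj (nb_graph n nb)) x (Ordinal n_gt0).
  by apply/'forall_forallP=> x y; rewrite (connect_trans (c0 x)) // cs.
have [m] := ubnP (val x); elim: m x => // m IHm x /= ltxm.
have [_ _ _ [x0|[y ltyx xy]]] := regular_bfsP (ltn_ord x).
  by rewrite (_ : x = Ordinal n_gt0) ?connect0 //; apply/val_inj.
have ltyn := ltn_trans ltyx (ltn_ord x).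
apply: connect_trans (IHm (Ordinal ltyn) _); last exact: leq_trans ltyx _.
by apply: connect1; rewrite adj_nb_graph.
Qed.

Lemma entry_table F x y : x < n -> y < n -> entry (table n F) x y = F x y.
Proof.
move=> ltxn ltyn; rewrite /entry /table.
by rewrite (nth_map 0) ?size_iota // (nth_map 0) ?size_iota // !nth_iota.
Qed.

Lemma sum_table F :
  sumn (flatten (table n F)) = \sum_(x < n) \sum_(y < n) F x y.
Proof.
rewrite sumn_flatten sumnE !big_map.
rewrite -(big_mkord xpredT (fun x => \sum_(y < n) F x y)).
rewrite /index_iota subn0; apply: eq_bigr => x _.
by rewrite sumnE big_map -(big_mkord xpredT (F x)) /index_iota subn0.
Qed.

Lemma nb_walk_sumsE : nb_walk_sums n nb =
  let w := walk_sums (adj (nb_graph n nb)) in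
  (bin_of_nat w.1, bin_of_nat w.2).
Proof.
rewrite /nb_walk_sums.
set W2 := table n (fun x y => count _ _); set W3 := table n (fun x y => sumn _).
have W2E (x y : 'I_n) : entry W2 x y = walks2 (adj (nb_graph n nb)) x y.
  rewrite entry_table // /walks2 -sum1_count big_mkcond /=.
  rewrite (eq_bigr (fun z => (z \in nth [::] nb y : nat))); last first.
    by move=> z _; case: (z \in _).
  rewrite (sum_nbrs (fun z => (z \in nth [::] nb y : nat))).
  by apply: eq_bigr => z _; rewrite adj_nb_graph.
have W3E (x y : 'I_n) : entry W3 x y = walks3 (adj (nb_graph n nb)) x y.
  rewrite entry_table // sumnE big_map (sum_nbrs (fun z => entry W2 z y)).
  by apply: eq_bigr => z _; rewrite W2E.
congr (bin_of_nat _, bin_of_nat _); rewrite sum_table;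
  by apply: eq_bigr => x _; apply: eq_bigr => y _; rewrite ?W2E W3E.
Qed.

Lemma embeddings_sound c f : f \in embeddings n nb c ->
  [/\ uniq f, all (gtn n) f & code (nb_adj nb) f = c].
Proof.
elim: c f => [|h c IHc] f /=; first by rewrite inE => /eqP->.
case/allpairsPdep=> g [x [/IHc[ug gn <-]]].
rewrite mem_filter => /andP[/and3P[ltxn xg /eqP hx] _] -> /=.
by rewrite xg ltxn hx.
Qed.

Lemma isomorphic_of_embeddings (G : sgraph 'I_n) P :
    uniq P -> size P = n -> embeddings n nb (code (adj G) P) != [::] ->
  isomorphic G (nb_graph n nb).
Proof.
case E: (embeddings _ _ _) => [|f fs] // uP sP _.
have [uf fn codef] :
    [/\ uniq f, all (gtn n) f & code (nb_adj nb) f = code (adj G) P].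
  by apply: embeddings_sound; rewrite E mem_head.
have [g fE] : exists g : seq 'I_n, f = map val g.
  exists (pmap insub f); rewrite (pmap_filter (insubK _)).
  symmetry; apply/all_filterP/allP=> x /(allP fn) ltxn /=.
  by rewrite insubT.
apply: (@code_isomorphic _ _ _ P g) => //; first by rewrite card_ord.
  by rewrite -(map_inj_uniq val_inj) -fE.
rewrite -codef fE code_map; apply: eq_code => x y.
by rewrite /= adj_nb_graph.
Qed.

End Decoding.

(** * Deciding 3-balancedness by enumerating colourings *)

Lemma colorings_proper (q : nat) (clash : rel nat) m s :
    s \in colorings q clash m ->
  [/\ size s = m, forall x, x < m -> nth 0 s x < q
    & forall x y, y < x -> x < m -> clash x y -> nth 0 s y != nth 0 s x].
Proof.
elim: m s => [|m IHm] s /=; first by rewrite inE => /eqP->.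
case/allpairsPdep=> t [c [/IHm[sizet tq tP]]].
rewrite mem_filter mem_iota add0n => /and3P[/allP cP _ ltcq] ->.
split=> [|x|x y ltyx]; first by rewrite size_rcons sizet.
  rewrite ltnS nth_rcons sizet leq_eqVlt.
  by case: ltngtP => //= ltxm _; apply: tq.
rewrite ltnS => lexm clxy; have ltym := leq_trans ltyx lexm.
rewrite !nth_rcons sizet ltym; move: lexm; rewrite leq_eqVlt.
case: ltngtP => //= [ltxm _|xm _]; first exact: tP.
have ym : y \in iota 0 m by rewrite mem_iota.
by apply: (implyP (cP y ym)); rewrite -xm.
Qed.

Lemma colorings_complete (q : nat) (clash : rel nat) (l : nat -> nat) m :
    (forall x, x < m -> l x < q) ->
    (forall x y, y < x -> x < m -> clash x y -> l y != l x) ->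
  mkseq l m \in colorings q clash m.
Proof.
elim: m => [|m IHm] lq lP /=; first by rewrite inE.
apply/allpairsPdep; exists (mkseq l m), (l m).
rewrite -mkseqS; split=> //.
  apply: IHm => [x ltxm|x y ltyx ltxm]; first by apply: lq; apply: ltnW.
  by apply: lP => //; apply: ltnW.
rewrite mem_filter mem_iota leq0n add0n lq //= andbT; apply/allP=> y.
rewrite mem_iota add0n => /andP[_ ltym]; apply/implyP=> clmy.
by rewrite nth_mkseq // lP.
Qed.

Lemma three_balanced_nb_graph n nb : regular_bfs 3 n nb ->
  three_balanced (nb_graph n nb) = (colorings 3 (siblings n nb) n != [::]).
Proof.
move=> nbP; have cub := cubic_nb_graph nbP (erefl _).
have sib (x y z : 'I_n) : adj (nb_graph n nb) z x -> adj (nb_graph n nb) z y ->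
    siblings n nb x y.
  rewrite !(adj_nb_graph nbP) => zx zy.
  apply/hasP; exists (val z); last exact/andP.
  by rewrite mem_iota add0n ltn_ord.
apply/existsP/idP => [[l /(balanced_coloringP _ cub) lP]|].
  (* [l] is extended by 0 to all naturals; only arguments below [n] are evaluated. *)
  have: mkseq (fun x => if insub x is Some i then val (l i) else 0) n
    \in colorings 3 (siblings n nb) n.
    apply: colorings_complete => [x ltxn|x y ltyx ltxn].
      by rewrite insubT ltn_ord.
    have ltyn := ltn_trans ltyx ltxn; rewrite !insubT /=.
    case/hasP=> z; rewrite mem_iota add0n => /andP[_ ltzn] /andP[zx zy].
    apply/eqP=> /val_inj lyx; have eqyx : Ordinal ltyn = Ordinal ltxn.
      by apply: (lP (Ordinal ltzn)) lyx; rewrite (adj_nb_graph nbP).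
    by case: eqyx ltyx => ->; rewrite ltnn.
  by case: (colorings _ _ _).
case E: (colorings _ _ _) => [|s ss] // _.
have [sizes sq sP] : [/\ size s = n, forall x, x < n -> nth 0 s x < 3
    & forall x y, y < x -> x < n -> siblings n nb x y ->
        nth 0 s y != nth 0 s x].
  by apply: colorings_proper; rewrite E mem_head.
exists [ffun x : 'I_n => inord (nth 0 s x) : 'Z_3].
apply/(balanced_coloringP _ cub).
move=> x y z xy xz; rewrite !ffunE => /(congr1 val).
rewrite /= !inordK ?sq // => lyz; apply/val_inj/eqP.
apply/idPn; rewrite neq_ltn => /orP[lt|lt].
  by have := sP _ _ lt (ltn_ord z) (sib _ _ _ xz xy); rewrite lyz eqxx.
by have := sP _ _ lt (ltn_ord y) (sib _ _ _ xy xz); rewrite lyz eqxx.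
Qed.

(** * From checked representatives to the number of classes *)

Lemma collect_reps_sound n cs reps reps' :
    collect_reps n cs reps = Some reps' ->
  {subset reps <= reps'} /\
  {in cs, forall c, exists2 r, r \in reps' & embeddings n r.2 c != [::]}.
Proof.
elim: cs reps => [|c cs IHcs] reps /=; first by case=> ->; split.
case: ifP => [/hasP[r rin]|_].
  case: ifP => // _ rc /IHcs[sub cov]; split=> // d.
  by case/predU1P=> [->|]; [exists r; first exact: sub | apply: cov].
(* A new representative is kept only after the code embeds into it, so the output of [nbrs] is
   validated by computation. *)
case: ifP => // nbc /IHcs[sub cov]; split=> [r rin|d].
  by apply: sub; rewrite inE rin orbT.
case/predU1P=> [->|]; last exact: cov.
by exists (nb_walk_sums n (nbrs n c), nbrs n c); first exact/sub/mem_head.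
Qed.

Lemma cubic12_codes_complete (V : finType) (G : sgraph V) :
    #|V| = 12 -> connected_graph G -> cubic G ->
  exists2 P, uniq P /\ size P = 12 & code (adj G) P \in cubic12_codes.
Proof.
move=> V12 /andP[/card_gt0P[x _] /'forall_forallP conn] /forallP cub.
have deg y : #|adj G y| = 3.
  by rewrite -(eqP (cub y)); apply: eq_card => z; rewrite inE.
have [|||||P []] :=
  @search_complete V (adj G) 3 (@adj_sym _ G) (@adj_irr _ G) deg
  conn 13 [::] [:: x] [:: (0, [::])]; rewrite ?V12 //.
by move=> uP sP Pin; exists P.
Qed.

Lemma map_uniq_inj (S T : eqType) (f : S -> T) s :
  uniq (map f s) -> {in s &, injective f}.
Proof.
elim: s => //= x s IHs /andP[fx us] y z.
rewrite !inE => /predU1P[->|ys] /predU1P[->|zs] //; last exact: IHs.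
  by move=> fxz; rewrite fxz map_f in fx.
by move=> fyx; rewrite -fyx map_f in fx.
Qed.

(** Abstract in [cs], so that simplification in the proof cannot start the large computation. *)
Lemma card_iso_classes_of_reps a b cs :
    (forall G : sgraph 'I_12, connected_graph G -> cubic G ->
      exists2 P, uniq P /\ size P = 12 & code (adj G) P \in cs) ->
    oapp (check_reps a b) false (collect_reps 12 cs [::]) ->
  #|iso_classes (connected_cubic_graphs 'I_12)| = a
  /\ #|iso_classes [set G in connected_cubic_graphs 'I_12 | three_balanced G]|
     = b.
Proof.
move=> csP; case E: (collect_reps _ _ _) => [reps|] //=.
have [_ cov] := collect_reps_sound E.
rewrite /check_reps; set nbs := [seq r.2 | r <- reps].
case/and4P=> /allP regP uniqW /eqP <- /eqP <-.
have unbs := map_uniq uniqW.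
pose g := nb_graph 12.
have g_inj : {in nbs &, forall i j, isomorphic (g i) (g j) -> i = j}.
  move=> i j ii jj /walk_sums_isomorphic eqw.
  apply: (map_uniq_inj uniqW ii jj).
  by rewrite (nb_walk_sumsE (regP i ii)) (nb_walk_sumsE (regP j jj)) eqw.
have g_cub i : i \in nbs -> cubic (g i).
  by move=> ii; apply: cubic_nb_graph (regP i ii) _.
have gA : {in nbs, forall i, g i \in connected_cubic_graphs 'I_12}.
  by move=> i ii; rewrite inE g_cub // (connected_nb_graph (regP i ii)).
have covA (G : sgraph 'I_12) : connected_graph G && cubic G ->
    exists2 i, i \in nbs & isomorphic G (g i).
  case/andP=> conG cubG; have [P [uP sP] Pcs] := csP G conG cubG.
  have [p rp emb] := cov _ Pcs; have pnb : p.2 \in nbs by apply: map_f.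
  by exists p.2 => //; exact: (isomorphic_of_embeddings (regP _ pnb) uP sP emb).
split.
  apply: (card_equivalence_partition (@isomorphic_equiv _) unbs g_inj gA).
  by move=> G; rewrite inE; apply: covA.
apply: (card_equivalence_partition (g := g) (@isomorphic_equiv _)
  (filter_uniq _ unbs)).
- by move=> i j; rewrite !mem_filter => /andP[_ ii] /andP[_ jj]; apply: g_inj.
- move=> i; rewrite mem_filter => /andP[bi ii].
  by rewrite inE gA //= three_balanced_nb_graph // regP.
move=> G; rewrite inE => /andP[]; rewrite inE => GA balG.
have [i ii Gi] := covA G GA; exists i => //; rewrite mem_filter ii andbT.
rewrite -three_balanced_nb_graph ?regP //.
by apply: three_balanced_isomorphic Gi balG; [case/andP: GA | apply: g_cub].
Qed.

Lemma cubic12_codes_checked :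
  oapp (check_reps 85 17) false (collect_reps 12 cubic12_codes [::]).
(* The kernel runs the whole search and check with the virtual machine at [Qed]. *)
Proof. vm_cast_no_check (erefl true). Qed.

Theorem theorem8p3 :
  #|iso_classes (connected_cubic_graphs 'I_12)| = 85
  /\ #|iso_classes [set G in connected_cubic_graphs 'I_12 | three_balanced G]|
     = 17.
Proof.
apply: card_iso_classes_of_reps cubic12_codes_checked => G.
by apply: cubic12_codes_complete; rewrite card_ord.
Qed.
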